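(* Let $\Sigma$ be a finite alphabet, let $X\subset\Sigma^{\mathbb{Z}}$ be a subshift, and let $\widehat X$ be the Kalikow-type subshift associated with $X$, with factor map $\pi:\{-1,1\}^{\mathbb{Z}}\times X\to\widehat X$. Let $\nu$ be a non-atomic shift-invariant Borel probability measure on $X$, let $P$ be the symmetric Bernoulli measure on $\{-1,1\}^{\mathbb{Z}}$ (the coordinates are i.i.d. with $P(x_0=1)=P(x_0=-1)=\tfrac12$), and let $\widehat\nu=(P\times\nu)\circ\pi^{-1}$. Then $\widehat\nu$ is $\mathfrak{T}_{\widehat X}$-invariant.
   Context: Kalikow-type subshift: let $X\subset\Sigma^{\mathbb{Z}}$ be a subshift with shift map $T$, $(Ty)_n=y_{n+1}$, and let $\sigma$ be the shift on $\{-1,1\}^{\mathbb{Z}}$. Let $\widehat{T}(x,y)=(\sigma x,T^{x_0}y)$ on $\{-1,1\}^{\mathbb{Z}}\times X$. Define $\pi:\{-1,1\}^{\mathbb{Z}}\times X\to(\{-1,1\}\times\Sigma)^{\mathbb{Z}}$ by $\pi(x,y)_n=(\widehat{T}^n(x,y))_0$, meaning the pair of $0$-th coordinates of the two components of $\widehat{T}^n(x,y)$; explicitly $\pi(x,y)_n=(x_n,\,y_{\Phi_n(x)})$ with $\Phi_n(x)=\sum_{j=0}^{n-1}x_j$ for $n>0$, $\Phi_0(x)=0$, $\Phi_n(x)=-\sum_{j=n}^{-1}x_j$ for $n<0$. The Kalikow-type subshift associated with $X$ is the image $\widehat{X}=\pi(\{-1,1\}^{\mathbb{Z}}\times X)$,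 a subshift of $(\{-1,1\}\times\Sigma)^{\mathbb{Z}}$. The Gibbs relation $\mathfrak{T}_{\widehat X}$ is the set of pairs $(z,z')\in\widehat X\times\widehat X$ with $z_n=z'_n$ for all but finitely many $n\in\mathbb{Z}$. A Borel probability measure $\mu$ on $\widehat X$ is $\mathfrak{T}_{\widehat X}$-invariant if $\mu(\gamma(A))=\mu(A)$ for every Borel isomorphism $\gamma:A\to B$ between Borel sets $A,B\subset\widehat X$ with $(z,\gamma(z))\in\mathfrak{T}_{\widehat X}$ for all $z\in A$. *)

(* Defs.v *)
From HB Require Import structures.
From mathcomp Require Import all_boot all_order all_algebra.
From mathcomp Require Import all_classical all_reals all_analysis.
From mathcomp Require Import zify.

Set Implicit Arguments.
Unset Strict Implicit.
Unset Printing Implicit Defensive.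

Import Order.TTheory GRing.Theory Num.Theory.

Local Open Scope classical_set_scope.
Local Open Scope ring_scope.

(* The distinguished point is there because the measurable types of the library
   are pointed; it excludes only the empty alphabet, over which there is no
   bi-infinite sequence. *)
#[short(type="alphabet")]
HB.structure Definition Alphabet := {A of Finite A & Pointed A}.

HB.instance Definition _ (A B : alphabet) := Pointed.on (A * B)%type.

(* The alphabet {-1, 1}, as a subtype of int; ssval is the inclusion. *)
Definition pm1 : Type := seq_sub [:: -1 : int; 1 : int].
HB.instance Definition _ := Finite.on pm1.
Definition plus1 : pm1 := @SeqSub int [:: -1; 1] 1 isT.
Definition minus1 : pm1 := @SeqSub int [:: -1; 1] (-1) isT.
HB.instance Definition _ := isPointed.Build pm1 plus1.

(* A^Z with the product of the discrete topologies and its Borel sets. *)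
Definition zseq (A : alphabet) : Type := {ptws int -> discrete_topology A}.

Section zseq_instances.
Variable A : alphabet.

HB.instance Definition _ := Topological.copy (zseq A)
  {ptws int -> discrete_topology A}.
HB.instance Definition _ := Pointed.copy (zseq A) (int -> A).

Let borel : set (set (zseq A)) := <<s @open (zseq A) >>.

Let borel0 : borel set0. Proof. exact: sigma_algebra0. Qed.

Let borelC U : borel U -> borel (~` U). Proof. exact: sigma_algebraC. Qed.

Let borelU (F : (set (zseq A))^nat) :
  (forall i, borel (F i)) -> borel (\bigcup_i F i).
Proof. exact: sigma_algebra_bigcup. Qed.

HB.instance Definition _ := @isMeasurable.Build
  (sigma_display (@open (zseq A))) (zseq A) borel borel0 borelC borelU.

End zseq_instances.

Section shift_spaces.
Variable A : alphabet.
Implicit Types (y : zseq A) (X Z : set (zseq A)).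

Definition shift y : zseq A := fun n => y (n + 1).

(* the k-th power of the shift, for k in Z *)
Definition shiftz (k : int) y : zseq A := fun n => y (n + k).

Definition subshift X := closed X /\ shift @` X = X.

Definition gibbs_relation Z : set (zseq A * zseq A) :=
  [set zz | [/\ Z zz.1, Z zz.2 & finite_set [set n | zz.1 n <> zz.2 n]]].

(* g restricted to U is a Borel isomorphism from U onto V; the values of g
   outside U are irrelevant. *)
Definition borel_isomorphism (U V : set (zseq A)) (g : zseq A -> zseq A) :=
  [/\ measurable U, measurable V, set_bij U V g, measurable_fun U g &
      forall C, measurable C -> C `<=` U -> measurable (g @` C)].

End shift_spaces.

(* Borel measures on a Borel set X are represented by the Borel measures on the
   full shift that give full mass to X. *)
Section measures_on_shift_spaces.
Variables (R : realType) (A : alphabet).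
Implicit Types (X Z : set (zseq A)) (mu : probability (zseq A) R).
Local Open Scope ereal_scope.

Definition carried_by X mu := mu X = 1.

Definition shift_invariant mu :=
  forall U, measurable U -> mu (@shift A @^-1` U) = mu U.

(* On a Polish space, and A^Z is one, every atom of a finite Borel measure is a
   point up to a null set. *)
Definition non_atomic mu := forall y, mu [set y] = 0.

Definition gibbs_invariant Z mu :=
  carried_by Z mu /\
  forall (U V : set (zseq A)) (g : zseq A -> zseq A),
    U `<=` Z -> V `<=` Z -> borel_isomorphism U V g ->
    (forall z, U z -> gibbs_relation Z (z, g z)) ->
    mu (g @` U) = mu U.

(* product rule over every finite subfamily of the coordinates *)
Definition independent_coordinates mu :=
  forall (s : seq int) (E : int -> set A), uniq s ->
    mu [set x | forall i, i \in s -> E i (x i)] =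
    \prod_(i <- s) mu [set x | E i (x i)].

End measures_on_shift_spaces.

Definition symmetric_bernoulli (R : realType) (P : probability (zseq pm1) R) :=
  independent_coordinates P /\
  forall n : int, P [set x | x n = plus1] = (2^-1 : R)%:E /\
                  P [set x | x n = minus1] = (2^-1 : R)%:E.

Section kalikow.
Variable Sigma : alphabet.
Implicit Types (x : zseq pm1) (y : zseq Sigma).

Definition skew (xy : zseq pm1 * zseq Sigma) : zseq pm1 * zseq Sigma :=
  (shift xy.1, shiftz (ssval (xy.1 0)) xy.2).

(* Negz m is - (m + 1), so the second sum ranges over - (m + 1) <= k <= -1. *)
Definition Phi (n : int) x : int :=
  match n with
  | Posz m => \sum_(j < m) ssval (x j)
  | Negz m => - \sum_(j < m.+1) ssval (x (Negz j))
  end.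

Definition kalikow_map (xy : zseq pm1 * zseq Sigma) : zseq (pm1 * Sigma)%type :=
  fun n => (xy.1 n, xy.2 (Phi n xy.1)).

Definition kalikow (X : set (zseq Sigma)) : set (zseq (pm1 * Sigma)%type) :=
  kalikow_map @` ([set: zseq pm1] `*` X).

End kalikow.

Section zseq_theory.
Variable A : alphabet.

Definition window (n : nat) (x : zseq A) : set (zseq A) :=
  [set z | forall i : int, (`|i| <= n)%N -> z i = x i].

Lemma nbhs_coord (x : zseq A) (i : int) : nbhs x [set z : zseq A | z i = x i].
Proof.
have := @proj_continuous int (fun=> discrete_topology A) i x [set x i].
by apply; exact: discrete_set1.
Qed.

Lemma nbhs_window n (x : zseq A) : nbhs x (window n x).
Proof.
pose s : seq int :=
  [seq Posz k | k <- iota 0 n.+1] ++ [seq - Posz k | k <- iota 0 n.+1].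
have sP (t : seq int) :
    nbhs x [set z : zseq A | forall i, i \in t -> z i = x i].
  elim: t => [|j t IH].
    rewrite (_ : mkset _ = setT); first exact: (@filterT _ (nbhs x) _).
    by apply/seteqP; split.
  apply: (@filterS _ (nbhs x) _ _ _ _
    (@filterI _ (nbhs x) _ _ _ (nbhs_coord x j) IH)) => z /= [zj zt] i.
  by rewrite in_cons => /predU1P[->|/zt].
apply: (@filterS _ (nbhs x) _ _ _ _ (sP s)) => z /= zs i ni.
apply: zs; rewrite mem_cat.
apply/orP; case: (intP i) ni => [|k|k] ni.
- by left; apply/mapP; exists 0%N => //; rewrite mem_iota.
- by left; apply/mapP; exists k.+1 => //; rewrite mem_iota.
- by right; apply/mapP; exists k.+1 => //; rewrite mem_iota; move: ni;
  rewrite abszN.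
Qed.

Lemma nbhs_windowP (x : zseq A) (U : set (zseq A)) :
  nbhs x U -> exists n, window n x `<=` U.
Proof.
pose F := filter_from [set: nat] (fun n => window n x).
have FF : Filter F.
  apply: filter_from_filter; first by exists 0%N.
  move=> i j _ _; exists (maxn i j) => // z zij.
  by split => k ki; apply: zij; rewrite leq_max ki ?orbT.
have Fx : F --> x; last by move=> xU; have [n _ nU] := Fx _ xU; exists n.
apply/cvg_sup => i V [/= W [[W' oW' W'W] Wx] WV].
exists `|i|%N => // z zx; apply: WV; rewrite -W'W /=.
by rewrite zx//; move: Wx; rewrite -W'W.
Qed.

Lemma open_measurable_zseq (U : set (zseq A)) : open U -> measurable U.
Proof. exact: sub_sigma_algebra. Qed.

Lemma closed_measurable_zseq (U : set (zseq A)) : closed U -> measurable U.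
Proof.
move=> cU; rewrite -[U]setCK; apply: measurableC.
by apply: open_measurable_zseq; exact: closed_openC.
Qed.

Lemma measurable_coord (i : int) (a : A) :
  measurable [set z : zseq A | z i = a].
Proof.
apply: open_measurable_zseq; rewrite openE => z /= za; rewrite /interior.
by have := nbhs_coord z i; rewrite za.
Qed.

Lemma measurable_fun_zseq d (T : measurableType d) (f : T -> zseq A) :
  (forall (i : int) (a : A), measurable [set t | f t i = a]) ->
  measurable_fun [set: T] f.
Proof.
move=> fi.
apply: (@measurability _ _ _ _ setT f (@open (zseq A))) => // _ [U oU <-].
rewrite setTI.
pose cyl n (w : {ffun 'I_(n + n).+1 -> A}) : set (zseq A) :=
  [set z | forall i : 'I_(n + n).+1, z (Posz i - Posz n) = w i].
have -> : U = \bigcup_n \bigcup_(w in [set w | cyl n w `<=` U]) cyl n w.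
  apply/seteqP; split=> [x Ux|x [n _ [w /= wU xw]]]; last exact: wU.
  have [n nU] : exists n, window n x `<=` U.
    by apply: nbhs_windowP; apply: open_nbhs_nbhs.
  exists n => //.
  exists [ffun i : 'I__ => x (Posz i - Posz n)] => /=; last first.
    by move=> i; rewrite ffunE.
  move=> z zx; apply: nU => i ni.
  have lt_i : (`|(i + Posz n)%R| < (n + n).+1)%N by move: ni; lia.
  have := zx (Ordinal lt_i); rewrite ffunE /=.
  by rewrite (_ : Posz `|(i + Posz n)%R| - Posz n = i)//; move: ni; lia.
rewrite preimage_bigcup; apply: bigcupT_measurable => n.
rewrite preimage_bigcup; apply: fin_bigcup_measurable => [|w _].
  exact: finite_finset.
rewrite (_ : _ @^-1` _ = \bigcap_(i in [set: 'I_(n + n).+1])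
    [set t | f t (Posz i - Posz n) = w i]).
  by apply: fin_bigcap_measurable => //; exact: finite_finset.
by apply/seteqP; split=> [t ft i _|t ft i]; [exact: ft|exact: ft].
Qed.

Lemma hausdorff_zseq : hausdorff_space (zseq A).
Proof. by apply: hausdorff_product => i; exact: discrete_hausdorff. Qed.

Lemma compact_zseq : compact [set: zseq A].
Proof.
have := @tychonoff int (fun=> discrete_topology A) (fun=> setT).
rewrite (_ : [set f | _] = setT); last by apply/seteqP; split.
apply=> _; apply: finite_compact; exact: (@finite_finset A).
Qed.

Lemma shiftzD k l (y : zseq A) : shiftz k (shiftz l y) = shiftz (k + l) y.
Proof. by apply/funext => n; rewrite /shiftz addrA. Qed.

End zseq_theory.

Section kalikow_theory.
Variable Sigma : alphabet.
Implicit Types (x : zseq pm1) (y : zseq Sigma) (xy : zseq pm1 * zseq Sigma).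

Lemma Phi0 x : Phi 0 x = 0. Proof. exact: big_ord0. Qed.

Lemma PhiS n x : Phi (n + 1) x = ssval (x 0) + Phi n (shift x).
Proof.
case: n => [m|m].
  rewrite -PoszD addn1 /Phi big_ord_recl; congr (_ + _).
  by apply: eq_bigr => j _; rewrite /shift /= /bump /= add1n -addn1 PoszD.
case: m => [|m].
  by rewrite /Phi/= big_ord0 big_ord1 /shift /= subrr.
have -> : Negz m.+1 + 1 = Negz m by rewrite !NegzE; lia.
rewrite /Phi [in RHS]/= [in LHS]/=.
rewrite [in RHS]big_ord_recl /=.
have -> : shift x (Negz 0) = x 0 by [].
rewrite opprD addrA subrr add0r; congr (- _); apply: eq_bigr => j _.
rewrite /shift; congr (ssval (x _)); rewrite !NegzE /= /bump /= add1n; lia.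
Qed.

(* The next two lemmas say that kalikow_map reads the 0-th coordinates along the
   orbit of skew. *)
Lemma kalikow_map0 xy : kalikow_map xy 0 = (xy.1 0, xy.2 0).
Proof. by rewrite /kalikow_map Phi0. Qed.

Lemma kalikow_map_skew xy : kalikow_map (skew xy) = shift (kalikow_map xy).
Proof.
apply/funext => n; rewrite /kalikow_map /skew /= /shiftz.
by rewrite {3}/shift PhiS addrC.
Qed.

Lemma eq_Phi n x x' :
  (forall i : int, (`|i| <= `|n|)%N -> x i = x' i) -> Phi n x = Phi n x'.
Proof.
move=> xx'; case: n xx' => m xx'; rewrite /Phi; [|congr (- _)];
  by apply: eq_bigr => j _; rewrite xx'//; have := ltn_ord j; lia.
Qed.

Lemma measurable_Phi n (k : int) : measurable [set x | Phi n x = k].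
Proof.
suff sumP (s : nat -> int) m (l : int) :
    measurable [set x : zseq pm1 | \sum_(j < m) ssval (x (s j)) = l].
  case: n => m; first exact: sumP.
  rewrite (_ : mkset _ =
      [set x : zseq pm1 | \sum_(j < m.+1) ssval (x (Negz j)) = - k]).
    exact: sumP.
  by apply/seteqP; split=> x /=; rewrite /Phi => H; lia.
elim: m l => [|m IH] l.
  have [->|l0] := eqVneq l 0.
    rewrite (_ : mkset _ = setT)//.
    by apply/seteqP; split=> // x _ /=; rewrite big_ord0.
  rewrite (_ : mkset _ = set0)//.
  apply/seteqP; split=> // x /=; rewrite big_ord0 => /esym/eqP.
  by rewrite (negbTE l0).
rewrite (_ : mkset _ = \bigcup_(a in [set: pm1])
   ([set x : zseq pm1 | x (s m) = a] `&`
    [set x : zseq pm1 | \sum_(j < m) ssval (x (s j)) = l - ssval a])).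
  apply: fin_bigcup_measurable => [|a _]; first exact: finite_finset.
  by apply: measurableI; [exact: measurable_coord|exact: IH].
apply/seteqP; split=> [x /=|x [a _ [/= <-]]]; rewrite big_ord_recr /=.
  by move=> <-; exists (x (s m)) => //; split => //=; rewrite addrK.
by move=> ->; rewrite subrK.
Qed.

Lemma measurable_kalikow_map : measurable_fun [set: _] (@kalikow_map Sigma).
Proof.
apply: measurable_fun_zseq => n [a b].
rewrite (_ : mkset _ = \bigcup_(k in [set: int])
    (([set x : zseq pm1 | x n = a] `&` [set x | Phi n x = k]) `*`
     [set y : zseq Sigma | y k = b])).
  apply: countable_bigcupT_measurable; first exact: countableP.
  move=> k; apply: measurableX; last exact: measurable_coord.
  by apply: measurableI; [exact: measurable_coord|exact: measurable_Phi].
apply/seteqP; split=> [[x y] [/= xa yb]|[x y] [k _ [[/= <- kE] /= <-]]].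
  by exists (Phi n x).
by rewrite /kalikow_map /= kE.
Qed.

Lemma continuous_kalikow_map : continuous (@kalikow_map Sigma).
Proof.
move=> xy U /nbhs_windowP[n nU].
pose N :=
  (\max_(i < n.+1) maxn `|Phi (Posz i) xy.1| `|Phi (- Posz i) xy.1|)%N.
exists (window n xy.1, window N xy.2).
  by split => /=; exact: nbhs_window.
move=> z [/= z1 z2]; apply: nU => i ni.
have Phi_i : Phi i z.1 = Phi i xy.1.
  by apply: eq_Phi => j ji; apply: z1; exact: leq_trans ni.
rewrite /kalikow_map Phi_i z1// z2//.
have lt_i : (`|i| < n.+1)%N by [].
apply: (@leq_trans
  (maxn `|Phi (Posz `|i|) xy.1| `|Phi (- Posz `|i|) xy.1|)).
  rewrite leq_max; have [->|->] : i = Posz `|i| \/ i = - Posz `|i| by lia.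
    by rewrite leqnn.
  by rewrite abszN absz_nat leqnn orbT.
exact: (leq_bigmax (Ordinal lt_i)).
Qed.

Lemma closed_kalikow (X : set (zseq Sigma)) : closed X -> closed (kalikow X).
Proof.
move=> cX; apply: compact_closed; first exact: hausdorff_zseq.
apply: continuous_compact.
  exact/continuous_subspaceT/continuous_kalikow_map.
apply: compact_setX; first exact: compact_zseq.
exact: (subclosed_compact cX (@compact_zseq _)).
Qed.

End kalikow_theory.

Section kalikow_measure.
Variables (R : realType) (Sigma : alphabet).
Variables (P : probability (zseq pm1) R) (nu : probability (zseq Sigma) R).
Local Open Scope ereal_scope.

Definition kalikow_measure : set (zseq (pm1 * Sigma)%type) -> \bar R :=
  pushforward (P \x nu) (@kalikow_map Sigma).

Let kalikow_measure0 : kalikow_measure set0 = 0.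
Proof. by rewrite /kalikow_measure /pushforward preimage_set0 measure0. Qed.

Let kalikow_measure_ge0 U : 0 <= kalikow_measure U.
Proof. exact: (measure_ge0 (P \x nu)). Qed.

Let kalikow_measure_sigma_additive : semi_sigma_additive kalikow_measure.
Proof.
have mpre U : measurable U -> measurable (@kalikow_map Sigma @^-1` U).
  move=> mU; rewrite -[Y in measurable Y]setTI.
  exact: measurable_kalikow_map.
move=> F mF tF mUF; rewrite /kalikow_measure /pushforward preimage_bigcup.
apply: measure_semi_sigma_additive => [n||]; first exact: mpre.
- apply/trivIsetP => /= i j _ _ ij; rewrite -preimage_setI.
  by move/trivIsetP : tF => /(_ _ _ _ _ ij) ->//; rewrite preimage_set0.
- by rewrite -preimage_bigcup; exact: mpre.
Qed.

HB.instance Definition _ := isMeasure.Build _ _ _ kalikow_measure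
  kalikow_measure0 kalikow_measure_ge0 kalikow_measure_sigma_additive.

Let kalikow_measureT : kalikow_measure setT = 1.
Proof.
by rewrite /kalikow_measure /pushforward preimage_setT probability_setT.
Qed.

HB.instance Definition _ :=
  Measure_isProbability.Build _ _ _ kalikow_measure kalikow_measureT.

Lemma kalikow_measure_carried (X : set (zseq Sigma)) :
  closed X -> carried_by X nu -> carried_by (kalikow X) kalikow_measure.
Proof.
move=> cX nuX; apply/eqP; rewrite eq_le; apply/andP; split.
  apply: probability_le1.
  by apply: closed_measurable_zseq; exact: closed_kalikow.
have mX : measurable X by exact: closed_measurable_zseq.
have <- : (P \x nu) ([set: zseq pm1] `*` X) = 1.
  transitivity (P setT * nu X); first exact: product_measure1E.
  by rewrite nuX mule1; exact: probability_setT.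
apply: le_measure; rewrite ?inE.
- exact: measurableX.
- rewrite -[Y in measurable Y]setTI; apply: measurable_kalikow_map => //.
  by apply: closed_measurable_zseq; exact: closed_kalikow.
- by move=> xy Xxy; exists xy.
Qed.

End kalikow_measure.

(* Main.v *)
(* Almost every walk Phi x visits every integer at arbitrarily late times, and
   then kalikow_map (x, y) determines (x, y). If kalikow_map (x, y) and
   kalikow_map (x', y') differ at finitely many coordinates and x is recurrent,
   then x' arises from x by flipping finitely many signs, the two walks
   eventually differ by a constant c, and recurrence forces y' to be the
   translate of y by c. So (x', y') is the image of (x, y) under one of the
   countably many maps (flip s) x (shift by c), each of which preserves P x nu.
   A Gibbs isomorphism therefore lifts, up to a null set, to a bijection that is
   piecewise equal to one of countably many measure-preserving automorphisms. *)

Require Import Defs.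
From HB Require Import structures.
From mathcomp Require Import all_boot all_order all_algebra.
From mathcomp Require Import all_classical all_reals all_analysis.
From mathcomp Require Import zify ring lra.

Set Implicit Arguments.
Unset Strict Implicit.
Unset Printing Implicit Defensive.

Import Order.TTheory GRing.Theory Num.Theory.
Import numFieldNormedType.Exports.

Local Open Scope classical_set_scope.
Local Open Scope ring_scope.

(** * Survival probabilities of the simple random walk below a barrier *)

Section staying_probability.
Variable R : realType.

(** The chance that a symmetric walk at distance [k] below a barrier does not reach it within [n]
    steps, by first-step analysis; [k = 0] means that the barrier is reached. *)
Fixpoint stay_prob (n k : nat) : R :=
  match n, k with
  | _, 0 => 0
  | 0, _.+1 => 1
  | n'.+1, k'.+1 => (stay_prob n' k' + stay_prob n' k'.+2) / 2
  end.

Lemma stay_prob0 n : stay_prob n 0 = 0. Proof. by case: n. Qed.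

Lemma stay_probSS n k :
  stay_prob n.+1 k.+1 = (stay_prob n k + stay_prob n k.+2) / 2.
Proof. by []. Qed.

Lemma stay_prob_itv n k : 0 <= stay_prob n k <= 1.
Proof.
elim: n k => [|n IH] [|k] /=; rewrite ?lexx ?ler01//.
by have := IH k; have := IH k.+2; lra.
Qed.

Lemma stay_probS n k : stay_prob n.+1 k <= stay_prob n k.
Proof.
elim: n k => [|n IH] [|k]; rewrite ?stay_prob0//.
  by case/andP: (stay_prob_itv 1 k.+1).
by rewrite (stay_probSS n.+1) (stay_probSS n k) ler_pM2r ?lerD.
Qed.

(* The limit in n is harmonic in k and vanishes at 0, hence it is linear in k;
   being bounded by 1, it is 0. *)
Lemma cvg_stay_prob k : stay_prob n k @[n --> \oo] --> 0.
Proof.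
have cv j : cvgn (stay_prob ^~ j).
  apply: nonincreasing_is_cvgn; last first.
    by exists 0 => _ [n _ <-]; case/andP: (stay_prob_itv n j).
  by apply/nonincreasing_seqP => n; exact: stay_probS.
pose l j : R := limn (stay_prob ^~ j).
have l_itv j : 0 <= l j <= 1.
  apply/andP; split.
    by apply: limr_ge => //; near=> n; case/andP: (stay_prob_itv n j).
  by apply: limr_le => //; near=> n; case/andP: (stay_prob_itv n j).
have l0 : l 0%N = 0.
  apply/cvg_lim => //; rewrite [X in X @ _ --> _](_ : _ = cst 0) //.
    exact: cvg_cst.
  by apply/funext => n; rewrite stay_prob0.
have lS j : l j.+2 = 2 * l j.+1 - l j.
  suff -> : l j.+1 = (l j + l j.+2) / 2 by lra.
  apply/cvg_lim => //; rewrite -cvg_shiftS /=.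
  by apply: cvgMl; apply: cvgD; exact: cv.
have lE j : l j = j%:R * l 1%N.
  suff : l j = j%:R * l 1%N /\ l j.+1 = j.+1%:R * l 1%N by case.
  elim: j => [|j [IH IHS]]; first by rewrite l0 mul0r mul1r.
  by split=> //; rewrite lS IHS IH -!natr1; ring.
have l1 : l 1%N = 0.
  apply/eqP; rewrite eq_le; case/andP: (l_itv 1%N) => l1_ge0 _.
  rewrite l1_ge0 andbT leNgt; apply/negP => l1_gt0.
  (* [m] exceeds the inverse of [l 1], so [l m = m * l 1] would exceed 1. *)
  pose m := (Num.trunc (l 1%N)^-1).+1.
  have : (l 1%N)^-1 < m%:R by exact: truncnS_gt.
  have /andP[_] := l_itv m; rewrite lE => ml1.
  by rewrite -(ltr_pM2r l1_gt0) mulVf ?gt_eqF//; lra.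
by rewrite (_ : 0 = l k); [exact: cv|rewrite lE l1 mulr0].
Unshelve. all: by end_near. Qed.

End staying_probability.

(** * One-sided excursions under the symmetric Bernoulli measure *)

Local Arguments Phi : simpl never.

Definition pm1_opp (a : pm1) : pm1 := if a == plus1 then minus1 else plus1.

Lemma pm1_cases (a : pm1) : a = plus1 \/ a = minus1.
Proof.
by have := ssvalP a; rewrite !inE => /orP[] /eqP aE; [right|left];
  exact: val_inj.
Qed.

Lemma pm1_oppK : involutive pm1_opp.
Proof. by move=> a; case: (pm1_cases a) => ->. Qed.

Lemma neq_pm1_opp (a b : pm1) : a <> b -> b = pm1_opp a.
Proof. by case: (pm1_cases a) => ->; case: (pm1_cases b) => ->. Qed.

Lemma PhiSr (m : nat) (x : zseq pm1) : Phi m.+1 x = Phi m x + ssval (x m).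
Proof. exact: big_ord_recr. Qed.

Section one_sided_excursion.
Variables (R : realType) (P : probability (zseq pm1) R).
Hypothesis PB : symmetric_bernoulli P.

Definition cylinder (i : nat) (w : nat -> pm1) : set (zseq pm1) :=
  [set x | forall j, (j < i)%N -> x (Posz j) = w j].

Lemma cylinderS i w a : cylinder i w `&` [set x | x (Posz i) = a] =
  cylinder i.+1 (fun j => if j == i then a else w j).
Proof.
apply/seteqP; split=> [x [/= xw xi] j|x xw].
  by rewrite ltnS leq_eqVlt; case: eqP => [->|_ /xw].
split=> /= [j ji|]; last by rewrite xw// eqxx.
by rewrite xw ?(ltn_eqF ji)// ltnW.
Qed.

Lemma measurable_cylinder i w : measurable (cylinder i w).
Proof.
elim: i => [|i IH].
  by rewrite (_ : cylinder _ _ = setT)//; apply/seteqP; split.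
rewrite (_ : w = fun j => if j == i then w i else w j); last first.
  by apply/funext => j; case: eqP => [->|].
by rewrite -cylinderS; apply: measurableI => //; exact: measurable_coord.
Qed.

Lemma prob_cylinder (i : nat) (w : nat -> pm1) :
  P (cylinder i w) = ((2^-1) ^+ i)%:E.
Proof.
have [ind half] := PB.
have := ind [seq Posz j | j <- iota 0 i] (fun n => [set w `|n|%N]).
rewrite map_inj_uniq ?iota_uniq; last by move=> ? ? [].
move=> /(_ isT).
rewrite (_ : [set x | _] = cylinder i w).
  move=> ->; rewrite big_map; elim: i => [|i IH]; first by rewrite big_nil.
  rewrite -addn1 iotaD big_cat/= IH add0n big_seq1 exprD EFinM expr1.
  by congr (_ * _)%E; case: (pm1_cases (w i)) => ->; case: (half i).
apply/seteqP; split=> x /= xw.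
  by move=> j ji; apply: (xw (Posz j)); apply: map_f; rewrite mem_iota.
by move=> _ /mapP[j + ->]; rewrite mem_iota => /xw.
Qed.

(* The sums 0, e x_i, e (x_i + x_(i+1)), ... stay below k for n steps; each step
   increments i and updates k to the remaining distance to the barrier. *)
Fixpoint stays (e : pm1) (n k i : nat) (x : zseq pm1) : bool :=
  match n, k with
  | _, 0 => false
  | 0, _.+1 => true
  | n'.+1, k'.+1 =>
      if x (Posz i) == e then stays e n' k' i.+1 x else stays e n' k'.+2 i.+1 x
  end.

Lemma staysS e n k i : [set x | stays e n.+1 k.+1 i x] =
  ([set x | x (Posz i) = e] `&` [set x | stays e n k i.+1 x]) `|`
  ([set x | x (Posz i) = pm1_opp e] `&` [set x | stays e n k.+2 i.+1 x]).
Proof.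
apply/seteqP; split=> x /=.
  by case: eqVneq => [->|/eqP/nesym/neq_pm1_opp ->]; [left|right].
case=> -[-> //]; first by rewrite eqxx.
by case: eqP => // /(congr1 (@ssval _ _)); case: (pm1_cases e) => ->.
Qed.

Lemma measurable_stays e n k i : measurable [set x | stays e n k i x].
Proof.
elim: n k i => [|n IH] [|k] i.
- by rewrite (_ : mkset _ = set0)//; apply/seteqP; split.
- by rewrite (_ : mkset _ = setT)//; apply/seteqP; split.
- by rewrite (_ : mkset _ = set0)//; apply/seteqP; split.
- by rewrite staysS; apply: measurableU; apply: measurableI => //;
    exact: measurable_coord.
Qed.

(** Fixing the coordinates before [i] lets the induction condition on the sign at [i]: both outcomes
    are cylinders of length [i + 1], so cylinder probabilities alone yield the recursion of
    [stay_prob]. *)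
Lemma prob_cylinder_stays e n k i (w : nat -> pm1) :
  P (cylinder i w `&` [set x | stays e n k i x]) =
  ((2^-1) ^+ i * stay_prob R n k)%:E.
Proof.
elim: n k i w => [|n IH] [|k] i w.
- rewrite (_ : [set x | _] = set0); last by apply/seteqP; split.
  by rewrite setI0 measure0 mulr0.
- rewrite (_ : [set x | _] = setT); last by apply/seteqP; split.
  by rewrite setIT prob_cylinder mulr1.
- rewrite (_ : [set x | _] = set0); last by apply/seteqP; split.
  by rewrite setI0 measure0 mulr0.
rewrite staysS setIUr 2!setIA 2!cylinderS measureU.
- rewrite [X in (X + _)%E]IH [X in (_ + X)%E]IH -EFinD stay_probSS.
  by congr (_%:E); rewrite exprS; field.
- by apply: measurableI; [exact: measurable_cylinder|exact: measurable_stays].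
- by apply: measurableI; [exact: measurable_cylinder|exact: measurable_stays].
apply/seteqP; split=> // x [[/(_ i (ltnSn i)) + _] [/(_ i (ltnSn i)) + _]].
rewrite eqxx => -> /(congr1 (@ssval _ _)).
by case: (pm1_cases e) => ->.
Qed.

Lemma prob_stays e n k : P [set x | stays e n k 0 x] = (stay_prob R n k)%:E.
Proof.
have := prob_cylinder_stays e n k 0 (fun=> plus1).
rewrite (_ : cylinder _ _ = setT); last by apply/seteqP; split.
by rewrite setTI expr0 mul1r.
Qed.

(** Here [k] is the distance from the current height [ssval e * Phi i x] to the barrier, and each
    step readjusts it; [k = 0] contradicts the bound at [m = i]. *)
Lemma bounded_stays (e : pm1) n (k i : nat) (x : zseq pm1) :
  (forall m : nat, (i <= m)%N ->
     ssval e * Phi m x < ssval e * Phi i x + Posz k) ->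
  stays e n k i x.
Proof.
elim: n k i => [|n IH] [|k] i xk; try by have := xk i (leqnn i); lia.
  by [].
rewrite /=; case: eqVneq => [xi|/eqP/nesym/neq_pm1_opp xi].
  apply: IH => m im; have := xk m (ltnW im); rewrite PhiSr xi.
  by case: (pm1_cases e) => -> /=; lia.
apply: IH => m im; have := xk m (ltnW im); rewrite PhiSr xi.
by case: (pm1_cases e) => -> /=; lia.
Qed.

Lemma measurable_bounded_above (e : pm1) (k : int) :
  measurable [set x | forall m : nat, ssval e * Phi m x < k].
Proof.
rewrite (_ : mkset _ = \bigcap_(m in [set: nat]) \bigcup_(j in [set: nat])
    [set x | Phi m x = ssval e * (k - Posz j.+1)]).
  apply: bigcap_measurableType => m _; apply: bigcup_measurable => j _.
  exact: measurable_Phi.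
apply/seteqP; split=> x /= xk m.
  move=> _; exists `|(k - 1 - ssval e * Phi m x)%R|%N => //=.
  by have := xk m; case: (pm1_cases e) => -> /=; lia.
have [j _ /= ->] := xk m I; case: (pm1_cases e) => -> /=; lia.
Qed.

(** Staying below the barrier forever entails staying there for [n] steps, whose probability tends
    to 0 as [n] grows. *)
Lemma null_bounded_above (e : pm1) (k : int) :
  P [set x | forall m : nat, ssval e * Phi m x < k] = 0.
Proof.
apply/eqP; rewrite eq_le measure_ge0 andbT.
have le_stay n : (P [set x | forall m : nat, (ssval e * Phi m x < k)%R] <=
    (stay_prob R n `|k|%N)%:E)%E.
  rewrite -(prob_stays e); apply: le_measure; rewrite ?inE.
  - exact: measurable_bounded_above.
  - exact: measurable_stays.
  move=> x xk; apply: bounded_stays => m _.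
  (* As [k <= |k|], the natural barrier [|k|] is no lower than [k]; nonpositive [k] is covered as
     well. *)
  by have := xk m; rewrite Phi0 mulr0; lia.
have cv : (stay_prob R n `|k|%N)%:E @[n --> \oo] --> 0%:E.
  by apply: cvg_EFin; [exact: nearW|exact: cvg_stay_prob].
rewrite -[leRHS]/(0%:E) -(cvg_lim _ cv)//.
apply: lime_ge; first by apply/cvg_ex; exists 0%:E.
exact: nearW.
Qed.

End one_sided_excursion.

(** * Recurrence of the simple random walk *)

(** Asking for arbitrarily late visits makes the property survive a change of finitely many
    signs. *)
Definition recurrent (x : zseq pm1) : Prop :=
  forall (a : int) (N : nat), exists2 m : nat, (N <= m)%N & Phi m x = a.

(** The increments are 1 or -1, so the walk cannot skip an integer. *)
Lemma Phi_ivt (x : zseq pm1) (a : int) (m d : nat) :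
  Phi m x <= a <= Phi (m + d)%N x ->
  exists2 j : nat, (m <= j)%N & Phi j x = a.
Proof.
elim: d => [|d IH] mad.
  by exists m => //; move: mad; rewrite addn0; lia.
have [ad|ad] := lerP a (Phi (m + d)%N x); first by apply: IH; lia.
exists (m + d.+1)%N; first by rewrite leq_addr.
move: mad; rewrite addnS PhiSr.
by case: (pm1_cases (x (m + d)%N)) => -> /=; lia.
Qed.

Lemma Phi_le (x : zseq pm1) (m : nat) : `|Phi m x| <= Posz m.
Proof.
elim: m => [|m IH]; first by rewrite Phi0.
by rewrite PhiSr; case: (pm1_cases (x m)) => -> /=; lia.
Qed.

Lemma unbounded_recurrent (x : zseq pm1) :
  (forall (e : pm1) (k : nat), exists m : nat, Posz k <= ssval e * Phi m x) ->
  recurrent x.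
Proof.
move=> ub a N.
(* Reaching height [k + M] takes at least [k + M] steps, so it happens at time [M] or later. *)
have ubN (e : pm1) (k M : nat) : exists2 m : nat, (M <= m)%N &
    Posz k <= ssval e * Phi m x.
  have [m kMm] := ub e (k + M)%N; exists m; last by lia.
  by have := Phi_le x m; move: kMm; case: (pm1_cases e) => -> /=; lia.
(* The walk is at or below [a] at a time [m] after [N], and at or above [a] at a later time; it
   meets [a] in between. *)
have [m Nm am] := ubN minus1 `|a|%N N.
have [m' mm' am'] := ubN plus1 `|a|%N m.
have [|j mj ja] := @Phi_ivt x a m (m' - m).
  by rewrite subnKC//; move: am am' => /=; lia.
by exists j => //; exact: leq_trans mj.
Qed.

Lemma measurable_recurrent : measurable [set x | recurrent x].
Proof.
rewrite (_ : mkset _ = \bigcap_(aN in [set: int * nat])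
    \bigcup_(m in [set m | aN.2 <= m]%N) [set x | Phi (Posz m) x = aN.1]).
  rewrite -[X in measurable X]setCK setC_bigcap; apply: measurableC.
  apply: countable_bigcupT_measurable => [|[a N]]; first exact: countableP.
  by apply: measurableC; apply: bigcup_measurable => m _; exact: measurable_Phi.
apply/seteqP; split=> x /= rx.
  by move=> [a N] _; have [m Nm ma] := rx a N; exists m.
by move=> a N; have [m Nm ma] := rx (a, N) I; exists m.
Qed.

(** A walk that is not recurrent is bounded on one side by some integer, and these countably many
    events are null. *)
Lemma bernoulli_recurrent (R : realType) (P : probability (zseq pm1) R) :
  symmetric_bernoulli P -> P [set x | ~ recurrent x] = 0.
Proof.
move=> PB.
pose B (n : nat) (e : pm1) :=
  [set x | forall m : nat, ssval e * Phi m x < Posz n].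
apply/negligibleP; first by apply: measurableC; exact: measurable_recurrent.
apply: (@negligibleS _ _ _ _ (\bigcup_n (B n plus1 `|` B n minus1))).
  move=> x /= nrx; apply: contrapT => nB; apply: nrx.
  apply: unbounded_recurrent => e k; apply: contrapT => nk.
  apply: nB; exists k => //.
  suff : B k e x by case: (pm1_cases e) => ->; [left|right].
  by move=> m; rewrite ltNge; apply/negP => km; apply: nk; exists m.
apply: negligible_bigcup => n; apply: negligibleU;
  (apply/negligibleP; first exact: measurable_bounded_above);
  exact: null_bounded_above.
Qed.

(** * Measure-preserving maps and bijections pieced together from them *)

Section measure_preserving.
Context d (T : measurableType d) (R : realType).
Variable mu : {measure set T -> \bar R}.

Definition preserves (f : T -> T) :=
  measurable_fun [set: T] f /\
  forall A, measurable A -> mu (f @^-1` A) = mu A.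

Lemma preserves_measurable f A :
  preserves f -> measurable A -> measurable (f @^-1` A).
Proof.
by move=> [mf _] mA; rewrite -[X in measurable X]setTI; exact: mf.
Qed.

(* Cut the domain into the measurable pieces on which f agrees with th n and not
   with any previous th m. *)
Lemma piecewise_preserves (f : T -> T) (th ti : nat -> T -> T) (W V : set T) :
  set_bij W V f -> (forall n, preserves (ti n)) ->
  (forall n, cancel (th n) (ti n)) -> (forall n, cancel (ti n) (th n)) ->
  (forall n, measurable (W `&` [set w | f w = th n w])) ->
  (forall w, W w -> exists n, f w = th n w) ->
  mu V = mu W.
Proof.
move=> [fWV f_inj f_surj] ti_pr thK tiK mB cover.
pose B n := W `&` [set w | f w = th n w].
pose A := seqDU B.
have AB n w : A n w -> W w /\ f w = th n w by case.
have mA n : measurable (A n) by exact: seqDU_measurable.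
have WE : W = \bigcup_n A n.
  rewrite -seqDU_bigcup_eq; apply/seteqP; split=> [w Ww|w [n _ []]//].
  by have [n fn] := cover w Ww; exists n.
(* The image of [A n] under [th n] is written as a preimage under the inverse [ti n], hence is
   measurable with the measure of [A n]. *)
have VE : V = \bigcup_n (ti n @^-1` A n).
  apply/seteqP; split=> [v Vv|v [n _ /= Av]].
    have [w Ww <-] := f_surj v Vv.
    move: (Ww); rewrite {1}WE => -[n _ Anw]; exists n => //=.
    by have [_ ->] := AB _ _ Anw; rewrite thK.
  by have [Ww] := AB _ _ Av; rewrite tiK => <-; exact: fWV.
(* By injectivity of [f], a point common to two images has a single preimage in [W], which would lie
   in two disjoint pieces. *)
have tA : trivIset [set: nat] (fun n => ti n @^-1` A n).
  apply/trivIsetP => i j _ _ ij; apply/seteqP; split=> // v [/= Ai Aj].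
  have [Wi] := AB _ _ Ai; rewrite tiK => fi.
  have [Wj] := AB _ _ Aj; rewrite tiK => fj.
  have eq_ij : ti i v = ti j v by apply: f_inj; rewrite ?inE ?fi.
  have /trivIsetP/(_ i j I I ij) := trivIset_seqDU B.
  by move=> /seteqP[+ _] => /(_ (ti i v)); apply; split => //; rewrite eq_ij.
rewrite VE WE !measure_bigcup//.
- by apply: eq_eseriesr => n _; case: (ti_pr n) => _; exact.
- exact: trivIset_seqDU.
- by move=> n _; exact: preserves_measurable.
Qed.

End measure_preserving.

Section shift_preserves.
Variables (R : realType) (A : alphabet) (nu : probability (zseq A) R).

Lemma measurable_shiftz k : measurable_fun [set: zseq A] (shiftz k).
Proof.
by apply: measurable_fun_zseq => i a; exact: (measurable_coord (i + k) a).
Qed.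

Lemma preserves_shiftz k : shift_invariant nu -> preserves nu (shiftz k).
Proof.
move=> nu_inv; split; first exact: measurable_shiftz.
have mpre l U : measurable U -> measurable (@shiftz A l @^-1` U).
  by move=> mU; rewrite -[X in measurable X]setTI; exact: measurable_shiftz.
have pos (m : nat) U : measurable U -> nu (@shiftz A m @^-1` U) = nu U.
  elim: m U => [|m IH] U mU.
    congr (nu _); apply/funext => y; rewrite /preimage /=.
    by congr (U _); apply/funext => n; rewrite /shiftz addr0.
  rewrite -(IH _ mU) -[RHS]nu_inv; last exact: mpre.
  congr (nu _); apply/funext => y; rewrite /preimage /=.
  by congr (U _); apply/funext => n; rewrite /shift /shiftz; congr (y _); lia.
move=> U mU; have [k0|k0] := lerP 0 k.
  by rewrite -[k]gez0_abs//; exact: pos.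
(* For negative [k], the shift by [|k|] preserves [nu] and cancels the shift by [k]. *)
transitivity (nu (@shiftz A `|k|%N @^-1` (@shiftz A k @^-1` U))).
  by rewrite pos//; exact: mpre.
congr (nu _); apply/funext => y; rewrite /preimage /=.
by rewrite shiftzD (_ : k + _ = 0); [congr (U _); apply/funext => n;
  rewrite /shiftz addr0|lia].
Qed.

End shift_preserves.

(** * Rectangles as a generating class, and sign flips *)

Section rectangles.
Variable A : alphabet.

(** The events of [independent_coordinates]; they form a pi-system that generates the Borel sets. *)
Definition rectangle : set (set (zseq A)) :=
  [set U | exists (s : seq int) (E : int -> set A),
    uniq s /\ U = [set x | forall i, i \in s -> E i (x i)]].

Lemma setI_closed_rectangle : setI_closed rectangle.
Proof.
move=> _ _ [s [E [us ->]]] [t [F [ut ->]]].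
exists (undup (s ++ t)),
  (fun i => [set a | (i \in s -> E i a) /\ (i \in t -> F i a)]).
split; first exact: undup_uniq.
apply/seteqP; split=> [x [/= xE xF] i _|x xEF].
  by split=> [/xE|/xF].
by split=> i it; have [|xE xF] := xEF i;
  rewrite ?mem_undup ?mem_cat ?it ?orbT//; [exact: xE|exact: xF].
Qed.

Lemma measurable_rectangles : @measurable _ (zseq A) = <<s rectangle >>.
Proof.
apply/seteqP; split=> U; last first.
  move: U; apply: smallest_sub.
    exact: sigma_algebra_measurable.
  move=> _ [s [E [_ ->]]].
  rewrite (_ : mkset _ = \bigcap_(i in [set` s]) \bigcup_(a in E i)
    [set x : zseq A | x i = a]).
    apply: fin_bigcap_measurable => // i _.
    apply: fin_bigcup_measurable => [|a _]; first exact: finite_finset.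
    exact: measurable_coord.
  apply/seteqP; split=> x /= xE i.
    by move=> /xE Ei; exists (x i).
  by move=> /xE [a Ea /= ->].
(* Single-coordinate events are rectangles, so the identity is measurable from the sigma-algebra of
   rectangles to the Borel one. *)
have mid : measurable_fun [set: g_sigma_algebraType rectangle]
    (id : _ -> zseq A).
  apply: measurable_fun_zseq => i a; apply: sub_sigma_algebra.
  exists [:: i], (fun=> [set a]); split => //.
  apply/seteqP; split=> x /= xa; last by apply: xa; rewrite inE.
  by move=> j; rewrite inE => /eqP ->.
by move=> /(mid measurableT); rewrite setTI.
Qed.

End rectangles.

Definition flip (s : seq int) (x : zseq pm1) : zseq pm1 :=
  fun n => if n \in s then pm1_opp (x n) else x n.

Lemma flipK s : involutive (flip s).
Proof.
move=> x; apply/funext => n; rewrite /flip.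
by case: (n \in s) => //; rewrite pm1_oppK.
Qed.

Lemma measurable_flip s : measurable_fun [set: zseq pm1] (flip s).
Proof.
apply: measurable_fun_zseq => i a; rewrite /flip; case: (i \in s).
  rewrite (_ : mkset _ = [set x : zseq pm1 | x i = pm1_opp a]).
    exact: measurable_coord.
  by apply/seteqP; split=> x /= => [<-|->]; rewrite pm1_oppK.
exact: measurable_coord.
Qed.

Section flip_preserves.
Variables (R : realType) (P : probability (zseq pm1) R).
Hypothesis PB : symmetric_bernoulli P.

(** Of the four subsets of the alphabet, the sign change fixes the empty and the full one and swaps
    the two singletons, both of probability 1/2. *)
Lemma prob_coord_opp (n : int) (E : set pm1) :
  P [set x | E (pm1_opp (x n))] = P [set x | E (x n)].
Proof.
have [_ half] := PB.
have [EP|EP] := pselect (E plus1); have [EM|EM] := pselect (E minus1).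
- by congr (P _); apply/seteqP; split=> x /= _; case: (pm1_cases (x n)) => ->.
- rewrite (_ : [set x | _] = [set x | x n = minus1]); last first.
    by apply/seteqP; split=> x /=; case: (pm1_cases (x n)) => ->.
  rewrite (_ : [set x | E _] = [set x | x n = plus1]); last first.
    by apply/seteqP; split=> x /=; case: (pm1_cases (x n)) => ->.
  by case: (half n) => -> ->.
- rewrite (_ : [set x | _] = [set x | x n = plus1]); last first.
    by apply/seteqP; split=> x /=; case: (pm1_cases (x n)) => ->.
  rewrite (_ : [set x | E _] = [set x | x n = minus1]); last first.
    by apply/seteqP; split=> x /=; case: (pm1_cases (x n)) => ->.
  by case: (half n) => -> ->.
- by congr (P _); apply/seteqP; split=> x /=; case: (pm1_cases (x n)) => ->.
Qed.

(** A flip pulls a rectangle back to one on the same coordinates with equal factors, and finite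
    measures agreeing on a generating pi-system that contains the whole space coincide. *)
Lemma preserves_flip s : preserves P (flip s).
Proof.
split; first exact: measurable_flip.
move=> U mU.
pose m' : {measure set (zseq pm1) -> \bar R} :=
  @measure_function_pushforward__canonical__measure_function_Measure
    _ _ _ _ _ P _ (measurable_flip s).
apply: (@measure_unique _ _ _ _ (fun=> setT) (@measurable_rectangles pm1)
  _ _ _ m' P) => //.
- exact: setI_closed_rectangle.
- by move=> _; exists [::], (fun=> setT); split => //; apply/seteqP; split.
- by rewrite bigcup_const.
- move=> _ [t [E [tu ->]]]; rewrite /m' /= /pushforward.
  have [ind _] := PB.
  pose F i := if i \in s then pm1_opp @^-1` E i else E i.
  transitivity (P [set x | forall i, i \in t -> F i (x i)]).
    congr (P _); apply/seteqP; split=> x /= xE i it; have := xE i it;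
      by rewrite /F /flip; case: (i \in s).
  rewrite (ind t F tu) (ind t E tu); apply: eq_bigr => i _.
  by rewrite /F; case: (i \in s) => //; exact: prob_coord_opp.
- by move=> _; rewrite /m' /= /pushforward preimage_setT probability_setT ltry.
Qed.

End flip_preserves.

(** * Product maps and coincidence sets of sequence-valued maps *)

Lemma preserves_prod d1 d2 (T1 : measurableType d1) (T2 : measurableType d2)
    (R : realType) (mu1 : probability T1 R) (mu2 : probability T2 R)
    (f1 : T1 -> T1) (f2 : T2 -> T2) :
  preserves mu1 f1 -> preserves mu2 f2 ->
  preserves (mu1 \x mu2)%E (fun w => (f1 w.1, f2 w.2)).
Proof.
move=> [mf1 pf1] [mf2 pf2].
have mf : measurable_fun [set: T1 * T2] (fun w => (f1 w.1, f2 w.2)).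
  apply: measurable_fun_pair.
    exact: (measurableT_comp mf1 measurable_fst).
  exact: (measurableT_comp mf2 measurable_snd).
split=> // U mU; apply/esym.
(* The pushforward has the product values on products of measurable sets, which determine the
   product measure. *)
apply: (@product_measure_unique _ _ _ _ _ _ _
  (@measure_function_pushforward__canonical__measure_function_Measure
    _ _ _ _ _ (mu1 \x mu2)%E _ mf)) => // A B mA mB.
rewrite /= /pushforward -pf1// -pf2//.
apply: product_measure1E; rewrite -[X in measurable X]setTI.
  exact: mf1.
exact: mf2.
Qed.

(** Equality is tested coordinate by coordinate and letter by letter: a countable intersection of
    finite unions. *)
Lemma measurable_eq_zseq d (T : measurableType d) (A : alphabet) (D : set T)
    (f g : T -> zseq A) :
  measurable D -> measurable_fun D f -> measurable_fun D g ->
  measurable (D `&` [set t | f t = g t]).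
Proof.
move=> mD mf mg.
have -> : D `&` [set t | f t = g t] = D `&` \bigcap_(i in [set: int])
    \bigcup_(a in [set: A]) ((D `&` f @^-1` [set z | z i = a]) `&`
                             (D `&` g @^-1` [set z | z i = a])).
  apply/seteqP; split=> [t [Dt /= fg]|t [Dt fg]]; split=> //.
    by move=> i _; exists (f t i) => //; split; split => //=; rewrite fg.
  by apply/funext => i; have [a _ [[_ /= ->] [_ /= ->]]] := fg i I.
apply: measurableI => //; rewrite -[X in measurable X]setCK setC_bigcap.
apply: measurableC; apply: countable_bigcupT_measurable => [|i].
  exact: countableP.
apply: measurableC; apply: fin_bigcup_measurable => [|a _].
  exact: finite_finset.
by apply: measurableI; [apply: mf|apply: mg] => //; exact: measurable_coord.
Qed.

(** * Lifting the Gibbs relation through [kalikow_map] *)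

Section gibbs.
Variable Sigma : alphabet.
Implicit Types (x : zseq pm1) (y : zseq Sigma) (w : zseq pm1 * zseq Sigma).

(** The index is a finite list with an integer, so the family is countable. *)
Definition flip_shift (k : seq int * int) w : zseq pm1 * zseq Sigma :=
  (flip k.1 w.1, shiftz k.2 w.2).

Lemma flip_shiftK s c :
  cancel (flip_shift (s, c)) (flip_shift (s, - c)).
Proof.
move=> [x y]; rewrite /flip_shift /= flipK shiftzD addNr.
by congr (_, _); apply/funext => n; rewrite /shiftz addr0.
Qed.

(** The first components give [x]; its walk visits every site, so the second components reveal all
    of [y]. *)
Lemma kalikow_map_inj w w' : recurrent w.1 ->
  kalikow_map w = kalikow_map w' -> w = w'.
Proof.
case: w w' => [x y] [x' y'] /= rx ww'.
have coord n : x n = x' n /\ y (Phi n x) = y' (Phi n x').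
  by have := congr1 (fun z => z n) ww'; rewrite /kalikow_map /= => -[].
have xx' : x = x' by apply/funext => n; case: (coord n).
rewrite -xx'; congr (_, _); apply/funext => a.
by have [m _ <-] := rx a 0%N; have [_] := coord m; rewrite -xx'.
Qed.

Lemma eventually_eq_Phi x x' (N : nat) :
  (forall m : nat, (N <= m)%N -> x m = x' m) ->
  forall m : nat, (N <= m)%N -> Phi m x' = Phi m x + (Phi N x' - Phi N x).
Proof.
move=> xx'; elim=> [|m IH]; first by rewrite leqn0 => /eqP ->; lia.
rewrite leq_eqVlt => /predU1P[->|]; first by lia.
by rewrite ltnS => Nm; rewrite !PhiSr IH// xx'//; lia.
Qed.

Lemma finite_set_int_bound (D : set int) : finite_set D ->
  exists N : nat, forall m : nat, (N <= m)%N -> ~ D m.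
Proof.
move=> /finite_seqP[s ->]; exists (\max_(i <- s) `|i|).+1%N => m sm /= ms.
have : (`|Posz m| <= \max_(i <- s) `|i|)%N by exact: leq_bigmax_seq.
by rewrite absz_nat leqNgt sm.
Qed.

(* From some time on the two walks differ by a constant c, and the first one
   takes every value there, so y and y' are translates of each other by c. *)
Lemma gibbs_flip_shift w w' : recurrent w.1 ->
  finite_set [set n | kalikow_map w n <> kalikow_map w' n] ->
  recurrent w'.1 /\ exists k, w' = flip_shift k w.
Proof.
case: w w' => [x y] [x' y'] /= rx fin.
have [N farN] := finite_set_int_bound fin.
have agree (m : nat) : (N <= m)%N -> x m = x' m /\ y (Phi m x) = y' (Phi m x').
  by move=> /farN /contrapT; rewrite /kalikow_map /= => -[].
have PhiE := @eventually_eq_Phi x x' N (fun m Nm => (agree m Nm).1).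
set c := Phi N x' - Phi N x in PhiE.
split.
  move=> a M; have [m] := rx (a - c) (maxn M N).
  by rewrite geq_max => /andP[Mm Nm] ma; exists m; rewrite ?PhiE// ma subrK.
have /finite_seqP[s sE] : finite_set [set n | x n <> x' n].
  by apply: sub_finite_set fin => n /= nx; rewrite /kalikow_map /= => -[].
exists (s, - c); rewrite /flip_shift /=; congr (_, _); apply/funext => n.
  have sP : (x n <> x' n) = (n \in s).
    by rewrite -[LHS]/([set n | x n <> x' n] n) sE.
  rewrite /flip; case: ifPn => [|/negP]; first by rewrite -sP => /neq_pm1_opp.
  by rewrite -sP => /contrapT.
rewrite /shiftz; have [m Nm mn] := rx (n - c) N.
by have [_] := agree m Nm; rewrite PhiE// mn subrK => <-.
Qed.

End gibbs.

(** * Gibbs invariance of the image measure *)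

Theorem proposition4p4 (R : realType) (Sigma : alphabet)
    (X : set (zseq Sigma)) (P : probability (zseq pm1) R)
    (nu : probability (zseq Sigma) R)
    (subX : subshift X) (nuX : carried_by X nu)
    (nu_inv : shift_invariant nu) (nu_na : non_atomic nu)
    (PB : symmetric_bernoulli P) :
  gibbs_invariant (kalikow X) (kalikow_measure P nu).
Proof.
have [cX _] := subX.
split; first exact: kalikow_measure_carried.
move=> U V g UX VX [mU mV gUV mg _] gibbs.
have [gV g_inj g_surj] := gUV.
rewrite (_ : g @` U = V); last first.
  by apply/seteqP; split=> // _ [z Uz <-]; exact: gV.
rewrite /kalikow_measure /pushforward.
pose G := [set w : zseq pm1 * zseq Sigma | recurrent w.1].
have mG : measurable G.
  rewrite (_ : G = [set x | recurrent x] `*` setT).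
    by apply: measurableX => //; exact: measurable_recurrent.
  by apply/seteqP; split=> [w Gw|w []].
pose W := (@kalikow_map Sigma @^-1` U) `&` G.
pose W' := (@kalikow_map Sigma @^-1` V) `&` G.
have mpre C : measurable C -> measurable (@kalikow_map Sigma @^-1` C).
  by move=> mC; rewrite -[Y in measurable Y]setTI;
    exact: measurable_kalikow_map.
(* Passing to [G], where [kalikow_map] is injective, discards only a null set. *)
have recur C : measurable C ->
    (P \x nu)%E (C `&` G) = (P \x nu)%E C.
  move=> mC.
  have PG : (P \x nu)%E (~` G) = 0.
    rewrite (_ : ~` G = [set x | ~ recurrent x] `*` setT).
      transitivity (P [set x | ~ recurrent x] * nu setT)%E.
        apply: product_measure1E => //.
        by apply: measurableC; exact: measurable_recurrent.
      by rewrite bernoulli_recurrent// mul0e.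
    by apply/seteqP; split=> [w Gw|w []].
  have mCG : measurable (C `&` ~` G).
    by apply: measurableI => //; exact: measurableC.
  rewrite -[in RHS](setUIDK C G) setDE measureU0//; first exact: measurableI.
  by apply: subset_measure0 PG => //; exact: measurableC.
rewrite -[LHS]recur; last exact: mpre.
rewrite -[RHS]recur; last exact: mpre.
(* A preimage of the value of [g] exists because [V] lies in [kalikow X]; it is recurrent because
   [g] moves points within their Gibbs class. *)
have lift w : W w -> exists w', W' w' /\ kalikow_map w' = g (kalikow_map w).
  move=> [/= Uw rw]; have /VX[w' _ w'E] := gV _ Uw.
  exists w'; split => //; split; first by rewrite /= w'E; exact: gV.
  have [_ _ fin] := gibbs _ Uw.
  by have [] := @gibbs_flip_shift _ w w' rw; rewrite /= ?w'E.
have /choice[f fE] : forall w, exists w',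
    W w -> W' w' /\ kalikow_map w' = g (kalikow_map w).
  move=> w; have [/lift[w' ?]|nW] := pselect (W w); first by exists w'.
  (* Outside [W] the condition is vacuous, and [w] serves as a default witness. *)
  by exists w.
(* An enumeration of all the maps [flip_shift]; numbers that code no index give the identity. *)
pose th n : zseq pm1 * zseq Sigma -> _ :=
  if unpickle n is Some k then flip_shift (k.1, k.2) else id.
pose ti n : zseq pm1 * zseq Sigma -> _ :=
  if unpickle n is Some k then flip_shift (k.1, - k.2) else id.
have flip_shift_pr k : preserves (P \x nu)%E (@flip_shift Sigma k).
  by apply: preserves_prod; [exact: preserves_flip|exact: preserves_shiftz].
have id_pr : preserves (P \x nu)%E (@id (zseq pm1 * zseq Sigma)) by [].
have th_pr n : preserves (P \x nu)%E (th n).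
  by rewrite /th; case: unpickle.
apply: (@piecewise_preserves _ _ _ _ f th ti W W').
- split=> [w Ww|w w' + + fww'|v [Vv rv]].
  + by have [] := fE w Ww.
  + rewrite !inE => Ww Ww'.
    have [_ gw] := fE w Ww; have [_ gw'] := fE w' Ww'.
    apply: kalikow_map_inj; first by case: Ww.
    apply: g_inj; rewrite ?inE; [by case: Ww|by case: Ww'|].
    by rewrite -gw -gw' fww'.
  (* Here [v] lies over [g z] and [u] over [z]; the Gibbs relation carries recurrence from [v] back
     to [u]. *)
  + have [z Uz gz] := g_surj _ Vv; have [u _ uz] := UX _ Uz.
    have [_ _ fin] := gibbs _ Uz.
    have Wu : W u.
      split; first by rewrite /= uz.
      have [|//] := @gibbs_flip_shift _ v u rv.
      by rewrite uz -gz; apply: sub_finite_set fin => n /= /nesym.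
    exists u => //; apply/esym/kalikow_map_inj => //.
    by have [_ ->] := fE u Wu; rewrite uz.
- by move=> n; rewrite /ti; case: unpickle.
- by move=> n; rewrite /th /ti; case: unpickle => // k; exact: flip_shiftK.
- move=> n; rewrite /th /ti; case: unpickle => // k.
  by have := @flip_shiftK Sigma k.1 (- k.2); rewrite opprK.
- move=> n; have mW : measurable W by apply: measurableI => //; exact: mpre.
  rewrite (_ : _ `&` _ = W `&`
      [set w | g (kalikow_map w) = kalikow_map (th n w)]).
    apply: measurable_eq_zseq => //.
      apply: (measurable_comp mU) => //; first by move=> _ [w [Uw _] <-].
      apply: (measurable_funS measurableT) => //.
      exact: measurable_kalikow_map.
    apply: (measurable_funS measurableT) => //.
    exact: (measurableT_comp (@measurable_kalikow_map _) (th_pr n).1).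
  apply/seteqP; split=> w [Ww /= fw]; split=> //=.
    by rewrite -fw; case: (fE w Ww).
  have [[_ rfw] gw] := fE w Ww.
  by apply: kalikow_map_inj => //; rewrite gw.
move=> w Ww; have [_ gw] := fE w Ww; have [Uw rw] := Ww.
have [|_ [k ->]] := @gibbs_flip_shift _ w (f w) rw.
  by rewrite gw; case: (gibbs _ Uw).
by exists (pickle k); rewrite /th pickleK; case: k.
Qed.
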